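(* Let $(X,d)$ be a proper and unbounded metric space. Then $X$ is uniformly bi-Lipschitz homogeneous and quasi-invertible if and only if $\hat X$ is $2$-point uniformly strongly quasi-Möbius homogeneous.
   Context: Write $a\simeq_L b$ for $L^{-1}b\le a\le Lb$. A metric space is proper if closed balls are compact. $X$ is uniformly bi-Lipschitz homogeneous if there is $L\ge1$ such that for all $x,y\in X$ there is a homeomorphism $f:X\to X$ with $f(x)=y$ and $d(f(u),f(v))\simeq_L d(u,v)$ for all $u,v\in X$. $X$ is quasi-invertible if for some $p\in X$ and $L\ge1$ there is a homeomorphism $\sigma_p:X\setminus\{p\}\to X\setminus\{p\}$ with $d(\sigma_p(x),\sigma_p(y))\simeq_L\dfrac{d(x,y)}{d(x,p)\,d(y,p)}$ for all $x,y\in X\setminus\{p\}$. $\hat X=X\cup\{\infty\}$ is equipped with the quasi-sphericalized distance $\hat d_p$ for a point $p\in X$ (the property in the claim does not depend on the choices): $\hat d_p$ is a distance on $\hat X$ with $\frac14 s_p\le\hat d_p\le s_p$, where $s_p(x,y)=\dfrac{d(x,y)}{(1+d(x,p))(1+d(y,p))}$ and $s_p(x,\infty)=\dfrac1{1+d(x,p)}$ for $x,y\in X$ (such a distance always exists). A homeomorphism $f:Z\to Z$ of a metric space $(Z,\delta)$ is $C$-strongly quasi-Möbius ($C\ge1$) if for all quadruples of distinct points $a,b,c,e\in Z$, $\dfrac{\delta(f(a),f(c))\,\delta(f(b),f(e))}{\delta(f(a),f(e))\,\delta(f(b),f(c))}\le C\,\dfrac{\delta(a,c)\,\delta(b,e)}{\delta(a,e)\,\delta(b,c)}$.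 $Z$ is $2$-point uniformly strongly quasi-Möbius homogeneous if there is $C\ge1$ such that for any two pairs $\{x,y\}$, $\{a,b\}$ of distinct points in $Z$ there is a $C$-strongly quasi-Möbius self-homeomorphism $f$ of $Z$ with $f(x)=a$ and $f(y)=b$. *)

(* Defs.v *)
From HB Require Import structures.
From mathcomp Require Import all_boot all_order all_algebra.
From mathcomp Require Import ring lra.
From mathcomp Require Import all_classical all_reals all_analysis.

Set Implicit Arguments.
Unset Strict Implicit.
Unset Printing Implicit Defensive.

Import Order.TTheory GRing.Theory Num.Theory.

Local Open Scope classical_set_scope.
Local Open Scope ring_scope.

Definition simeq (R : realType) (L a b : R) : Prop := L^-1 * b <= a <= L * b.

Definition homeomorphism (S T : topologicalType) (f : S -> T) : Prop :=
  continuous f /\ exists g : T -> S, [/\ cancel f g, cancel g f & continuous g].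

(* The library's [closed_ball] is the closure of the open ball, which can be
   smaller than the ball [d(x, y) <= r] meant here. *)
Definition proper_space (R : realType) (X : metricType R) : Prop :=
  forall (x : X) (r : R), compact [set y : X | mdist x y <= r].

Definition unbounded_space (R : realType) (X : metricType R) : Prop :=
  ~ exists M : R, forall x y : X, mdist x y <= M.

Definition uniformly_biLipschitz_homogeneous (R : realType) (X : metricType R)
    : Prop :=
  exists2 L : R, 1 <= L & forall x y : X, exists f : X -> X,
    [/\ homeomorphism f, f x = y &
        forall u v : X, simeq L (mdist (f u) (f v)) (mdist u v)].

(* [[set~ p]] is coerced to the subtype of the points of X other than p, with
   the topology induced by X. *)
Definition quasi_invertible (R : realType) (X : metricType R) : Prop :=
  exists (p : X) (L : R), 1 <= L /\
  exists sigma : [set~ p] -> [set~ p], homeomorphism sigma /\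
    forall x y : [set~ p],
      simeq L (mdist (set_val (sigma x)) (set_val (sigma y)))
        (mdist (set_val x) (set_val y) /
          (mdist (set_val x) p * mdist (set_val y) p)).

(* [None] is the point at infinity of X^ = option X. *)
Definition sphericalization_gauge (R : realType) (X : metricType R) (p : X)
    (u v : option X) : R :=
  match u, v with
  | Some x, Some y => mdist x y / ((1 + mdist x p) * (1 + mdist y p))
  | Some x, None | None, Some x => 1 / (1 + mdist x p)
  | None, None => 0
  end.

Record quasi_sphericalized_distance (R : realType) (X : metricType R) (p : X) :=
  QuasiSphericalizedDistance {
  qsdist :> option X -> option X -> R ;
  qsdistxx : forall u, qsdist u u = 0 ;
  qsdist_positivity : forall u v, qsdist u v = 0 -> u = v ;
  qsdist_sym : forall u v, qsdist u v = qsdist v u ;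
  qsdist_triangle : forall v u w, qsdist u w <= qsdist u v + qsdist v w ;
  qsdist_gauge : forall u v,
    4^-1 * sphericalization_gauge p u v <= qsdist u v
      <= sphericalization_gauge p u v
}.

Definition sphericalization (R : realType) (X : metricType R) (p : X)
  (dh : quasi_sphericalized_distance p) : Type := option X.

HB.instance Definition _ (R : realType) (X : metricType R) (p : X)
  (dh : quasi_sphericalized_distance p) := Choice.on (sphericalization dh).
HB.instance Definition _ (R : realType) (X : metricType R) (p : X)
  (dh : quasi_sphericalized_distance p) :=
  isMetric.Build R (sphericalization dh) (qsdistxx dh)
    (@qsdist_positivity _ _ _ dh) (qsdist_sym dh) (qsdist_triangle dh).

Lemma sphericalization_mdistE (R : realType) (X : metricType R) (p : X)
    (dh : quasi_sphericalized_distance p) (u v : sphericalization dh) :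
  mdist u v = dh u v.
Proof. by []. Qed.

Definition strongly_quasi_Moebius (R : realType) (Z : metricType R) (C : R)
    (f : Z -> Z) : Prop :=
  forall a b c e : Z, uniq [:: a; b; c; e] ->
    (mdist (f a) (f c) * mdist (f b) (f e)) /
      (mdist (f a) (f e) * mdist (f b) (f c))
    <= C * ((mdist a c * mdist b e) / (mdist a e * mdist b c)).

Definition two_point_uniformly_strongly_quasi_Moebius_homogeneous
    (R : realType) (Z : metricType R) : Prop :=
  exists2 C : R, 1 <= C & forall x y a b : Z, x != y -> a != b ->
    exists f : Z -> Z,
      [/\ homeomorphism f, strongly_quasi_Moebius C f, f x = a & f y = b].

(* Quasi-sphericalized distances exist: the largest pseudo-distance below the
   gauge is one. *)
Section Existence.
Context (R : realType) (X : metricType R) (p : X).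

Local Notation g := (sphericalization_gauge p).

Let h (u : option X) : R := if u is Some x then (1 + mdist x p)^-1 else 0.

Let h_ge0 u : 0 <= h u.
Proof. by case: u => [x|] //=; rewrite invr_ge0 addr_ge0 ?mdist_ge0. Qed.

Let g_sym u v : g u v = g v u.
Proof.
by case: u v => [x|] [y|] //=; rewrite metric_sym [X in _ / X]mulrC.
Qed.

Let g_Some x y : g (Some x) (Some y) = mdist x y * (h (Some x) * h (Some y)).
Proof. by rewrite /= invfM. Qed.

Let g_ge0 u v : 0 <= g u v.
Proof.
case: u v => [x|] [y|] //; first by rewrite g_Some !mulr_ge0 ?mdist_ge0.
all: by rewrite /= div1r; apply: (h_ge0 (Some _)).
Qed.

Let hd x : h (Some x) * (1 + mdist x p) = 1.
Proof. by rewrite /= mulVf// gt_eqF// ltr_pwDl// mdist_ge0. Qed.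

Let h_le_g u v : h u - h v <= g u v.
Proof.
case: u v => [x|] [y|].
- rewrite g_Some; have := metric_triangle y x p; rewrite (metric_sym y x).
  have := hd x; have := hd y; have := h_ge0 (Some x); have := h_ge0 (Some y).
  move: (h (Some x)) (h (Some y)) (mdist x y) (mdist x p) (mdist y p).
  move=> a b d dx dy b0 a0 hb ha tri.
  have -> : a - b = (dy - dx) * (a * b).
    have -> : (dy - dx) * (a * b) = a * (b * (1 + dy)) - b * (a * (1 + dx)).
      by ring.
    by rewrite hb ha !mulr1.
  by apply: ler_wpM2r; [rewrite mulr_ge0|lra].
- by rewrite /= subr0 div1r.
- by rewrite sub0r (le_trans _ (g_ge0 _ _))// oppr_le0.
- by rewrite subrr.
Qed.

Let g_le_h u v : g u v <= h u + h v.
Proof.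
case: u v => [x|] [y|].
- rewrite g_Some; have := metric_triangle x p y; rewrite (metric_sym p y).
  have := hd x; have := hd y; have := h_ge0 (Some x); have := h_ge0 (Some y).
  move: (h (Some x)) (h (Some y)) (mdist x y) (mdist x p) (mdist y p).
  move=> a b d dx dy b0 a0 hb ha tri.
  have ab0 : 0 <= a * b by rewrite mulr_ge0.
  apply: (le_trans (ler_wpM2r ab0 tri)).
  have -> : (dx + dy) * (a * b) =
      b * (a * (1 + dx)) + a * (b * (1 + dy)) - 2 * (a * b) by ring.
  by rewrite hb ha !mulr1; lra.
- by rewrite /= addr0 div1r.
- by rewrite /= add0r div1r.
- by rewrite addr0.
Qed.

Let g_eq0 u v : g u v = 0 -> u = v.
Proof.
have h_gt0 x : 0 < h (Some x) by rewrite /= invr_gt0 ltr_pwDl// mdist_ge0.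
case: u v => [x|] [y|] //.
- rewrite g_Some => /eqP; rewrite mulf_eq0 (gt_eqF (mulr_gt0 _ _))// orbF.
  by move=> /eqP /mdist_positivity ->.
- by rewrite /= div1r => h0; have := h_gt0 x; rewrite /= h0 ltxx.
- by rewrite /= div1r => h0; have := h_gt0 y; rewrite /= h0 ltxx.
Qed.

Fixpoint chain_length (u : option X) (s : seq (option X)) (v : option X) : R :=
  if s is w :: s' then g u w + chain_length w s' v else g u v.

Local Notation len := chain_length.

Let len_cat u s w t v : len u (s ++ w :: t) v = len u s w + len w t v.
Proof. by elim: s u => [|z s IH] u //=; rewrite IH addrA. Qed.

Let len_rev u s v : len v (rev s) u = len u s v.
Proof.
elim: s u => [|w s IH] u /=; first exact: g_sym.
by rewrite rev_cons -cats1 len_cat IH /= g_sym addrC.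
Qed.

Let len_ge0 u s v : 0 <= len u s v.
Proof. by elim: s u => [|w s IH] u //=; rewrite addr_ge0. Qed.

Let h_le_len u s v w : w \in rcons s v -> h u - h w <= len u s v.
Proof.
elim: s u => [|z s IH] u /=; first by rewrite inE => /eqP ->.
rewrite inE => /predU1P[->|/(IH z) le_zw].
  by rewrite (le_trans (h_le_g _ _))// lerDl.
by have := h_le_g u z; lra.
Qed.

Let mdist_le_len x s y m : 0 < m -> m <= h (Some x) ->
  {in rcons s (Some y), forall w, m <= h w} ->
  mdist x y * (m * m) <= len (Some x) s (Some y).
Proof.
move=> m_gt0; have m0 := ltW m_gt0.
have step x1 x2 : m <= h (Some x1) -> m <= h (Some x2) ->
    mdist x1 x2 * (m * m) <= g (Some x1) (Some x2).
  by move=> m1 m2; rewrite g_Some ler_wpM2l ?mdist_ge0// ler_pM.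
elim: s x => [|[z|] s IH] x mx ms.
- by apply: step => //; apply: ms; rewrite inE.
- have mz : m <= h (Some z) by apply: ms; rewrite inE eqxx.
  have {}IH := IH z mz (fun w ws => ms w (mem_behead (s := _ :: _) ws)).
  have tri := metric_triangle x z y.
  have := ler_wpM2r (mulr_ge0 m0 m0) tri; rewrite mulrDl => /le_trans; apply.
  exact: lerD (step x z mx mz) IH.
- by have := ms None; rewrite inE eqxx /= leNgt m_gt0 => /(_ isT).
Qed.

Let gauge_le_len u s v : 4^-1 * g u v <= len u s v.
Proof.
wlog huv : u s v / h v <= h u => [hw|].
  have [/hw//|/ltW/hw] := leP (h v) (h u).
  by move=> /(_ (rev s)); rewrite len_rev g_sym.
have g_le := g_le_h u v.
have [/hasP[w ws hw]|] := boolP (has (fun w => h w < h u / 2) (rcons s v)).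
  by have := h_le_len u ws; lra.
rewrite -all_predC => /allP ms.
have {}ms : {in rcons s v, forall w, h u / 2 <= h w}.
  by move=> w /ms /=; rewrite -leNgt.
case: u => [x|] in huv g_le ms *; last first.
  by have := len_ge0 None s v; rewrite /= in huv g_le ms *; lra.
have hx : 0 < h (Some x) by rewrite /= invr_gt0 ltr_pwDl// mdist_ge0.
case: v => [y|] in huv g_le ms *; last first.
  have := ms None; rewrite mem_rcons inE eqxx => /(_ isT).
  by rewrite /= in hx *; lra.
have hx2 : 0 < h (Some x) / 2 by lra.
have hx2_le : h (Some x) / 2 <= h (Some x) by lra.
apply: le_trans (mdist_le_len hx2 hx2_le ms).
rewrite g_Some mulrCA ler_wpM2l ?mdist_ge0//.
have := ler_wpM2l (h_ge0 (Some x)) huv.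
by move: (h (Some x)) (h (Some y)) => a b; lra.
Qed.

Let chain_dist u v : R := inf [set len u s v | s in setT].

Let chain_dist_le u s v : chain_dist u v <= len u s v.
Proof.
apply: ge_inf; last by exists s.
by exists 0 => _ [t _ <-].
Qed.

Let le_chain_dist u v m : (forall s, m <= len u s v) -> m <= chain_dist u v.
Proof.
move=> mlen; apply: lb_le_inf; first by exists (len u [::] v), [::].
by move=> _ [s _ <-].
Qed.

Let chain_dist_gauge u v : 4^-1 * g u v <= chain_dist u v <= g u v.
Proof.
by rewrite le_chain_dist ?(chain_dist_le u [::])//= => s; exact: gauge_le_len.
Qed.

Lemma quasi_sphericalized_distance_exists :
  inhabited (quasi_sphericalized_distance p).
Proof.
split; apply: (@QuasiSphericalizedDistance _ _ _ chain_dist) => //.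
- move=> u; have /andP[ge le] := chain_dist_gauge u u; apply/eqP.
  have g0 : g u u = 0 by case: u {ge le} => //= x; rewrite mdistxx mul0r.
  by rewrite eq_le -{1}g0 le (le_trans _ ge)// g0 mulr0.
- move=> u v duv; have /andP[ge _] := chain_dist_gauge u v; apply: g_eq0.
  by apply/eqP; rewrite eq_le g_ge0 andbT; rewrite duv in ge; lra.
- have le u v : chain_dist u v <= chain_dist v u.
    by apply: le_chain_dist => s; rewrite -len_rev chain_dist_le.
  by move=> u v; apply/eqP; rewrite eq_le !le.
- move=> v u w; rewrite -lerBlDr; apply: le_chain_dist => s.
  rewrite lerBlDr -lerBlDl; apply: le_chain_dist => t.
  by rewrite lerBlDl -len_cat chain_dist_le.
Qed.

End Existence.

(* Main.v *)
Require Import Defs.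
From mathcomp Require Import all_boot all_order all_algebra.
From mathcomp Require Import ring lra.
From mathcomp Require Import all_classical all_reals all_analysis.

Set Implicit Arguments.
Unset Strict Implicit.
Unset Printing Implicit Defensive.

Import Order.TTheory GRing.Theory Num.Theory.
Import numFieldNormedType.Exports.

Local Open Scope classical_set_scope.
Local Open Scope ring_scope.

(** Let [rho = extended_dist], which is d on X and 1 between a point of X and
infinity.  Every quasi-sphericalized distance is comparable to rho multiplied
by a conformal factor w(u) w(v), and conformal factors cancel in cross-ratios.
So strong quasi-Moebius control on the sphericalization means control of the
cross-ratios of rho, where a distance to infinity counts as 1.

From left to right: a bi-Lipschitz map of X, extended by fixing infinity,
distorts rho by a bounded factor.  A quasi-inversion s at q, extended by
swapping q and infinity, distorts rho by a bounded factor times the conformal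
factor 1/d(x,q) of each point.  This needs d(s(x),q) to be comparable to
1/d(x,q) ([inversion_norm]), which follows from the estimate that defines s by
letting the second point y go to infinity, because s(y) then
accumulates at q and nowhere else: any other limit would be some s(v), while
d(s(v),s(y)) stays comparable to 1/d(v,q).  With a bounded number of such maps
every pair of distinct points is carried to (q, infinity)
([pair_to_center_infinity]), hence to every other pair.  Self-homeomorphisms
come for free, since a bijection that is conformal for a bounded distance is
locally Lipschitz.

From right to left: a strongly quasi-Moebius map that swaps p and infinity is a
quasi-inversion, up to a multiplicative constant that is absorbed in L because
only one such map is needed ([Moebius_swapping_infinity_inversion]).  A strongly
quasi-Moebius map f that fixes infinity multiplies d by some lambda up to a
uniform factor ([Moebius_fixing_infinity_quasi_similarity]), but homogeneity
gives no control on lambda.  The normalization of lambda is the heart of the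
proof ([quasi_similarity_biLipschitz_homogeneous]).  Let f(x) = y.  If lambda is
far from 1, then f or its inverse is a true contraction of the complete space
X, so f has a fixed point z.  If k is a quasi-similarity with k(z) = y, the
commutator k f^-1 k^-1 f still sends x to y, and its scale is that of a
commutator, namely 1. *)

(** * Comparability up to a constant *)

Lemma simeqP (R : realType) (L a b : R) : 0 < L ->
  simeq L a b <-> a <= L * b /\ b <= L * a.
Proof.
move=> L0; rewrite /simeq mulrC ler_pdivrMr// [a * L]mulrC.
by split => [/andP[]|[-> ->]].
Qed.

Lemma simeq_refl (R : realType) (L a : R) : 1 <= L -> 0 <= a -> simeq L a a.
Proof.
move=> L1 a0; apply/simeqP; first exact: lt_le_trans L1.
by split; apply: ler_peMl.
Qed.

Lemma simeq_sym (R : realType) (L a b : R) : 0 < L ->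
  simeq L a b -> simeq L b a.
Proof. by move=> L0 /(simeqP _ _ L0)[ab ba]; apply/(simeqP _ _ L0). Qed.

Lemma simeq_trans (R : realType) (K L a b c : R) : 0 < K -> 0 < L ->
  simeq K a b -> simeq L b c -> simeq (K * L) a c.
Proof.
move=> K0 L0 /(simeqP _ _ K0)[ab ba] /(simeqP _ _ L0)[bc cb].
apply/simeqP; first exact: mulr_gt0.
rewrite -mulrA [K * L]mulrC -mulrA; split.
  by apply: le_trans ab _; rewrite ler_pM2l.
by apply: le_trans cb _; rewrite ler_pM2l.
Qed.

Lemma simeq_weaken (R : realType) (K L a b : R) : 0 < K -> K <= L -> 0 <= a ->
  simeq K a b -> simeq L a b.
Proof.
move=> K0 KL a0 /(simeqP _ _ K0)[ab ba].
have b0 : 0 <= b by rewrite -(pmulr_rge0 _ K0) (le_trans a0).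
apply/simeqP; first exact: lt_le_trans KL.
by split; [apply: le_trans ab _ | apply: le_trans ba _]; rewrite ler_wpM2r.
Qed.

Lemma simeq_mul2l (R : realType) (L a b c : R) : 0 < L -> 0 <= c ->
  simeq L a b -> simeq L (c * a) (c * b).
Proof.
move=> L0 c0 /(simeqP _ _ L0)[ab ba].
by apply/simeqP => //; split; rewrite mulrCA ler_wpM2l.
Qed.

Lemma simeqM (R : realType) (K L a b c e : R) : 0 < K -> 0 < L ->
  0 <= a -> 0 <= c -> simeq K a b -> simeq L c e -> simeq (K * L) (a * c) (b * e).
Proof.
move=> K0 L0 a0 c0 ab ce.
have b0 : 0 <= b.
  by move/(simeqP _ _ K0): ab => [ab _]; rewrite -(pmulr_rge0 _ K0) (le_trans a0).
apply: (@simeq_trans _ _ _ _ (b * c)) => //.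
  by rewrite ![_ * c]mulrC; exact: simeq_mul2l.
exact: simeq_mul2l.
Qed.

Lemma simeqV (R : realType) (L a b : R) : 0 < L -> 0 <= a ->
  simeq L a b -> simeq L a^-1 b^-1.
Proof.
move=> L0 a0 /(simeqP _ _ L0)[ab ba].
have b0 : 0 <= b by rewrite -(pmulr_rge0 _ L0) (le_trans a0).
apply/simeqP => //.
have [a_eq0|a_neq0] := eqVneq a 0.
  have -> : b = 0 by apply/eqP; rewrite eq_le b0 andbT -(mulr0 L) -a_eq0.
  by rewrite a_eq0 !invr0 mulr0.
have {a_neq0} {}a0 : 0 < a by rewrite lt_neqAle eq_sym a_neq0.
have {}b0 : 0 < b by rewrite -(pmulr_rgt0 _ L0) (lt_le_trans a0).
by rewrite !ler_pdivlMr// ![_^-1 * _]mulrC !ler_pdivrMr.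
Qed.

(** * Lipschitz estimates and continuity *)

(** The map k allows for the inclusion of a subspace, whose topology is induced
by the distance of the ambient space. *)
Lemma locally_lipschitz_continuous (R : realType) (T : topologicalType)
    (Y Z : metricType R) (k : T -> Y) (f : T -> Z) (r M : R) (x : T) :
  continuous k -> 0 < r ->
  (forall t, mdist (k x) (k t) < r ->
     mdist (f x) (f t) <= M * mdist (k x) (k t)) ->
  {for x, continuous f}.
Proof.
move=> kc r0 fM; apply/metricType_numDomainType.cvgrPdist_lt => e e0.
have M1 : 0 < `|M| + 1 by rewrite ltr_wpDl.
have d0 : 0 < Num.min r (e / (`|M| + 1)) by rewrite lt_min r0 divr_gt0.
have kx := (metricType_numDomainType.cvgrPdist_lt _ _).1 (kc x) _ d0.
near=> t; have : mdist (k x) (k t) < Num.min r (e / (`|M| + 1)).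
  by near: t; exact: kx.
rewrite lt_min => /andP[/fM ft].
rewrite ltr_pdivlMr// => te; apply: le_lt_trans ft (le_lt_trans _ te).
by rewrite mulrC ler_wpM2l ?mdist_ge0//; have := ler_norm M; lra.
Unshelve. all: by end_near. Qed.

Lemma biLipschitz_homeomorphism (R : realType) (X : metricType R) (L : R)
    (f g : X -> X) : 0 < L -> cancel f g -> cancel g f ->
  (forall u v, simeq L (mdist (f u) (f v)) (mdist u v)) -> homeomorphism f.
Proof.
move=> L0 fK gK fL.
have lip h : (forall u v, mdist (h u) (h v) <= L * mdist u v) -> continuous h.
  move=> hL x; apply: (@locally_lipschitz_continuous _ _ _ _ id _ 1 L) => //.
  by move=> ?; exact: cvg_id.
split; first by apply: lip => u v; have /(simeqP _ _ L0)[] := fL u v.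
exists g; split => //; apply: lip => u v.
by have /(simeqP _ _ L0)[_] := fL (g u) (g v); rewrite !gK.
Qed.

(** * Distances equal up to a conformal factor *)

Definition pullback (R S T : Type) (f : S -> T) (delta : T -> T -> R) u v :=
  delta (f u) (f v).

Definition conformally_equivalent (R : realType) (T : Type) (L : R)
    (delta1 delta2 : T -> T -> R) : Prop :=
  exists2 w : T -> R, (forall u, 0 < w u) &
    forall u v, simeq L (delta1 u v) (w u * w v * delta2 u v).

Lemma conformally_equivalent_sym (R : realType) (T : Type) (L : R)
    (delta1 delta2 : T -> T -> R) : 0 < L ->
  conformally_equivalent L delta1 delta2 ->
  conformally_equivalent L delta2 delta1.
Proof.
move=> L0 [w w0 dw]; exists (fun u => (w u)^-1) => [u|u v].
  by rewrite invr_gt0.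
have ww0 : 0 < w u * w v by rewrite mulr_gt0.
rewrite -invfM -[X in simeq L X _](mulKf (lt0r_neq0 ww0)).
by apply: simeq_mul2l => //; [rewrite invr_ge0 ltW | exact: simeq_sym].
Qed.

Lemma conformally_equivalent_trans (R : realType) (T : Type) (K L : R)
    (delta1 delta2 delta3 : T -> T -> R) : 0 < K -> 0 < L ->
  conformally_equivalent K delta1 delta2 ->
  conformally_equivalent L delta2 delta3 ->
  conformally_equivalent (K * L) delta1 delta3.
Proof.
move=> K0 L0 [w w0 d12] [w' w'0 d23].
exists (fun u => w u * w' u) => [u|u v]; first by rewrite mulr_gt0.
rewrite [w u * _ * _]mulrACA -[_ * _ * delta3 u v]mulrA.
apply: simeq_trans (d12 u v) _ => //.
by apply: simeq_mul2l => //; rewrite mulr_ge0// ltW.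
Qed.

Lemma conformally_equivalent_pullback (R : realType) (S T : Type) (L : R)
    (f : S -> T) (delta1 delta2 : T -> T -> R) :
  conformally_equivalent L delta1 delta2 ->
  conformally_equivalent L (pullback f delta1) (pullback f delta2).
Proof.
by move=> [w w0 d12]; exists (w \o f) => [u|u v]; [exact: w0 | exact: d12].
Qed.

(** Up to the constant L, this is the square root of the identity
|f(u) - f(v)|^2 = |f'(u)| |f'(v)| |u - v|^2 of Moebius maps, w^2 being |f'|. *)
Definition conformal (R : realType) (T : Type) (L : R) (delta : T -> T -> R)
    (f : T -> T) : Prop := conformally_equivalent L (pullback f delta) delta.

Lemma conformal_comp (R : realType) (T : Type) (K L : R)
    (delta : T -> T -> R) (f g : T -> T) : 0 < K -> 0 < L ->
  conformal K delta f -> conformal L delta g ->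
  conformal (K * L) delta (g \o f).
Proof.
move=> K0 L0 cf cg; rewrite mulrC.
apply: conformally_equivalent_trans cf => //.
exact: (conformally_equivalent_pullback f cg).
Qed.

Lemma conformal_inverse (R : realType) (T : Type) (L : R)
    (delta : T -> T -> R) (f g : T -> T) : 0 < L -> cancel g f ->
  conformal L delta f -> conformal L delta g.
Proof.
move=> L0 gK /(conformally_equivalent_pullback g).
move=> /(conformally_equivalent_sym L0) [w w0 d]; exists w => // u v.
by have := d u v; rewrite /pullback !gK.
Qed.

Lemma conformal_weaken (R : realType) (T : Type) (K L : R)
    (delta : T -> T -> R) (f : T -> T) : 0 < K -> K <= L ->
  (forall u v, 0 <= delta u v) -> conformal K delta f -> conformal L delta f.
Proof.
move=> K0 KL d0 [w w0 fw]; exists w => // u v.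
by apply: simeq_weaken (fw u v) => //; exact: d0.
Qed.

(** * Cross-ratios *)

Definition cross_ratio (R : realType) (T : Type) (delta : T -> T -> R)
    (a b c e : T) : R :=
  delta a c * delta b e / (delta a e * delta b c).

(** Each of the four points occurs once in the numerator and once in the
denominator, so the conformal factors cancel. *)
Lemma simeq_cross_ratio (R : realType) (T : Type) (L : R)
    (delta1 delta2 : T -> T -> R) (a b c e : T) : 0 < L ->
  (forall u v, 0 <= delta1 u v) -> conformally_equivalent L delta1 delta2 ->
  simeq (L ^+ 4) (cross_ratio delta1 a b c e) (cross_ratio delta2 a b c e).
Proof.
move=> L0 d0 [w w0 d12].
have pair u v u' v' : simeq (L * L) (delta1 u v * delta1 u' v')
    (w u * w v * delta2 u v * (w u' * w v' * delta2 u' v')).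
  exact: simeqM.
have -> : L ^+ 4 = L * L * (L * L) by ring.
have -> : cross_ratio delta2 a b c e =
    (w a * w c * delta2 a c * (w b * w e * delta2 b e)) /
    (w a * w e * delta2 a e * (w b * w c * delta2 b c)).
  have W0 : w a * w b * w c * w e != 0.
    by rewrite lt0r_neq0// !mulr_gt0.
  have -> : w a * w c * delta2 a c * (w b * w e * delta2 b e) =
    w a * w b * w c * w e * (delta2 a c * delta2 b e) by ring.
  have -> : w a * w e * delta2 a e * (w b * w c * delta2 b c) =
    w a * w b * w c * w e * (delta2 a e * delta2 b c) by ring.
  by rewrite -mulf_div divff// mul1r.
apply: simeqM (pair _ _ _ _) (simeqV _ _ (pair _ _ _ _)); do ?exact: mulr_gt0.
- exact: mulr_ge0.
- by rewrite invr_ge0 mulr_ge0.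
- exact: mulr_ge0.
Qed.

Lemma conformal_strongly_quasi_Moebius (R : realType) (Z : metricType R)
    (L : R) (f : Z -> Z) : 0 < L -> conformal L (@mdist R Z) f ->
  strongly_quasi_Moebius (L ^+ 4) f.
Proof.
move=> L0 cf a b c e _.
have := @simeq_cross_ratio _ _ _ _ _ a b c e L0 _ cf.
have dge0 u v : 0 <= pullback f (@mdist R Z) u v by exact: mdist_ge0.
by move=> /(_ dge0) /simeqP -/(_ (exprn_gt0 _ L0)) [].
Qed.

(** The conformal factor need not be continuous, but it is bounded near x:
comparing t with a fixed y away from x gives w(t) w(y) d(t,y) <= L B, where
d(t,y) is bounded below.  So f is Lipschitz at x. *)
Lemma conformal_continuous (R : realType) (Z : metricType R) (L B : R)
    (f : Z -> Z) : 0 < L -> (forall u v : Z, mdist u v <= B) ->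
  (forall x : Z, exists y, y != x) -> conformal L (@mdist R Z) f ->
  continuous f.
Proof.
move=> L0 dB other [w w0 fw] x.
have [y yx] := other x; pose r := mdist x y / 2.
have r0 : 0 < r by rewrite divr_gt0// mdist_gt0 eq_sym.
pose W := L * B / (w y * r).
apply: (@locally_lipschitz_continuous _ _ _ _ id _ r (L * (w x * W))) => //.
  by move=> ?; exact: cvg_id.
move=> t xt.
have ty : r <= mdist t y.
  by have := metric_triangle x t y; rewrite /r in xt *; lra.
have wt : w t <= W.
  have wr0 : 0 < w y * r by exact: mulr_gt0.
  rewrite ler_pdivlMr//.
  have /(simeqP _ _ L0)[_] := fw t y.
  move=> wty; rewrite mulrA; apply: le_trans (le_trans wty _).
    by rewrite ler_pM2l ?mulr_gt0.
  by rewrite ler_pM2l//; exact: dB.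
move: W wt => W wt.
have /(simeqP _ _ L0)[+ _] := fw x t; rewrite {1}/pullback => /le_trans; apply.
by rewrite -!mulrA ler_pM2l// ler_pM2l// ler_wpM2r ?mdist_ge0.
Qed.

(** Exchanging a and b inverts the cross-ratio, which turns the upper bound for
f into a lower bound. *)
Lemma strongly_quasi_Moebius_inverse (R : realType) (Z : metricType R) (C : R)
    (f g : Z -> Z) : 0 < C -> cancel g f -> strongly_quasi_Moebius C f ->
  strongly_quasi_Moebius C g.
Proof.
move=> C0 gK fC a b c e abce.
have g_inj := can_inj gK.
have ne (x y : Z) : x != y -> 0 < mdist x y :> R by rewrite mdist_gt0.
have /fC : uniq [:: g b; g a; g c; g e].
  move: abce; rewrite /= !inE !(inj_eq g_inj) !negb_or.
  by rewrite (eq_sym b a); case/and4P => /and3P[-> -> ->] /andP[-> ->] ->.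
rewrite !gK.
move: abce; rewrite /= !inE !negb_or => /and4P[/and3P[ab ac ae] /andP[bc be] ce _].
have X1 : 0 < mdist a c * mdist b e :> R by rewrite mulr_gt0 ?ne.
have X2 : 0 < mdist a e * mdist b c :> R by rewrite mulr_gt0 ?ne.
have Y1 : 0 < mdist (g a) (g c) * mdist (g b) (g e) :> R.
  by rewrite mulr_gt0 ?ne ?inj_eq.
have Y2 : 0 < mdist (g a) (g e) * mdist (g b) (g c) :> R.
  by rewrite mulr_gt0 ?ne ?inj_eq.
rewrite (mulrC (mdist b c)) (mulrC (mdist b e)).
rewrite (mulrC (mdist (g b) (g c))) (mulrC (mdist (g b) (g e))).
move: X1 X2 Y1 Y2.
move: (_ a c * _) (_ a e * _) (_ (g a) (g c) * _) (_ (g a) (g e) * _).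
move=> x1 x2 y1 y2 X1 X2 Y1 Y2.
rewrite ler_pdivrMr// mulrA mulrAC ler_pdivlMr// => h.
by rewrite ler_pdivrMr// mulrA mulrAC ler_pdivlMr// mulrC mulrAC.
Qed.

(** * The conformal class of the sphericalization *)

(** This is not a distance (the triangle inequality through infinity
fails in general), but it is the representative of the conformal class of the
sphericalization that makes the cross-ratios involving infinity simplest. *)
Definition extended_dist (R : realType) (X : metricType R) (u v : option X) : R :=
  match u, v with
  | Some x, Some y => mdist x y
  | Some _, None | None, Some _ => 1
  | None, None => 0
  end.

Lemma extended_dist_ge0 (R : realType) (X : metricType R) (u v : option X) :
  0 <= extended_dist u v.
Proof. by case: u v => [x|] [y|] //=; exact: mdist_ge0. Qed.

Lemma sphericalization_conformally_equivalent (R : realType)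
    (X : metricType R) (p : X) (dh : quasi_sphericalized_distance p) :
  conformally_equivalent 4 (@mdist R (sphericalization dh))
    (@extended_dist R X).
Proof.
have p0 x : 0 < 1 + mdist x p :> R by rewrite ltr_pwDl// mdist_ge0.
(* The gauge is exactly rho times this conformal factor. *)
exists (fun u : sphericalization dh =>
    if u is Some x then (1 + mdist x p)^-1 else 1).
  by move=> [x|] //; rewrite invr_gt0.
move=> u v; rewrite [mdist _ _]sphericalization_mdistE.
have -> : (if u is Some x then (1 + mdist x p)^-1 else 1) *
    (if v is Some x then (1 + mdist x p)^-1 else 1) * extended_dist u v =
    sphericalization_gauge p u v.
  case: u v => [x|] [y|] /=; rewrite ?mulr0 ?mulr1 ?mul1r//.
  by rewrite invfM mulrC.
have := qsdist_gauge dh u v => /andP[ge le].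
have g0 : 0 <= sphericalization_gauge p u v.
  case: u v {ge le} => [x|] [y|] /=;
    by rewrite ?divr_ge0 ?mulr_ge0 ?mdist_ge0// ltW.
by apply/simeqP => //; split; lra.
Qed.

Lemma sphericalization_bounded (R : realType) (X : metricType R) (p : X)
    (dh : quasi_sphericalized_distance p) (u v : sphericalization dh) :
  mdist u v <= 1.
Proof.
rewrite [mdist _ _]sphericalization_mdistE.
have /andP[_ /le_trans] := qsdist_gauge dh u v; apply.
have p0 (x : X) : 0 < 1 + mdist x p :> R by rewrite ltr_pwDl// mdist_ge0.
have p1 (x : X) : 1 <= 1 + mdist x p :> R by rewrite lerDl mdist_ge0.
case: u v => [x|] [y|] /=; rewrite ?ler01// ler_pdivrMr ?mulr_gt0// mul1r//.
have := metric_triangle x p y; rewrite (metric_sym p y).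
have := mulr_ge0 (mdist_ge0 x p) (mdist_ge0 y p); lra.
Qed.

Lemma strongly_quasi_Moebius_extended_dist (R : realType) (X : metricType R)
    (p : X) (dh : quasi_sphericalized_distance p) (C : R)
    (f : sphericalization dh -> sphericalization dh) : 0 < C ->
  strongly_quasi_Moebius C f ->
  forall a b c e : option X, uniq [:: a; b; c; e] ->
    cross_ratio (pullback f (@extended_dist R X)) a b c e <=
    4 ^+ 4 * (C * (4 ^+ 4 * cross_ratio (@extended_dist R X) a b c e)).
Proof.
move=> C0 fC a b c e abce.
have K0 : 0 < 4 ^+ 4 :> R by rewrite exprn_gt0.
have dd := sphericalization_conformally_equivalent dh.
have dge0 : forall u v : sphericalization dh, 0 <= mdist u v :> R.
  by move=> u v; exact: mdist_ge0.
have fdge0 u v : 0 <= pullback f (@mdist R (sphericalization dh)) u v.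
  exact: mdist_ge0.
have h0 : 0 < 4 :> R by [].
have /(simeqP _ _ K0)[_ le1] :=
  simeq_cross_ratio a b c e h0 fdge0 (conformally_equivalent_pullback f dd).
have /(simeqP _ _ K0)[le2 _] := simeq_cross_ratio a b c e h0 dge0 dd.
apply: le_trans le1 _; rewrite ler_pM2l//.
by apply: le_trans (fC a b c e abce) _; rewrite ler_pM2l.
Qed.

(** * Quasi-similarities *)

(** A closed ball that f maps into itself is compact, so the displacement
d(u, f(u)) attains its minimum there; f shrinks displacements, so the minimum
is 0. *)
Lemma contraction_fixpoint (R : realType) (X : metricType R) (k : R)
    (f : X -> X) (x0 : X) : proper_space X -> 0 <= k -> k < 1 ->
  (forall u v, mdist (f u) (f v) <= k * mdist u v) -> exists z, f z = z.
Proof.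
move=> Xproper k0 k1 fk.
(* The geometric series d(x0, f x0) (1 + k + k^2 + ...), which bounds the
   distance from x0 to its iterates. *)
pose r := mdist x0 (f x0) / (1 - k); pose B := [set y : X | mdist x0 y <= r].
have rE : mdist x0 (f x0) = (1 - k) * r.
  by rewrite mulrC divfK// gt_eqF// subr_gt0.
have r0 : 0 <= r by rewrite divr_ge0 ?mdist_ge0// subr_ge0 ltW.
have fB y : B y -> B (f y).
  rewrite /B /= => By; have := metric_triangle x0 (f x0) (f y).
  by have := ler_wpM2l k0 By; have := fk x0 y; lra.
have B0 : B !=set0 by exists x0; rewrite /B /= mdistxx.
have phi_continuous : continuous (fun u => mdist u (f u) : R).
  move=> u; apply/cvgrPdist_lt => e e0.
  have e2 : 0 < e / 2 by rewrite divr_gt0.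
  near=> v.
  have uv : mdist u v < e / 2.
    near: v.
    exact: (metricType_numDomainType.cvgrPdist_lt _ _).1 (@cvg_id _ (nbhs u)) _ e2.
  have fuv : mdist (f u) (f v) <= mdist u v.
    by apply: le_trans (fk u v) _; rewrite ler_piMl ?mdist_ge0// ltW.
  have h1 := metric_triangle u v (f u); have h2 := metric_triangle v (f v) (f u).
  have h3 := metric_triangle v u (f v); have h4 := metric_triangle u (f u) (f v).
  rewrite (metric_sym (f v)) in h2; rewrite (metric_sym v u) in h3.
  by rewrite ltr_distl; apply/andP; split; lra.
have [z /set_mem Bz zmin] := compact_EVT_min B0 (Xproper x0 r)
  (continuous_subspaceT phi_continuous).
exists z; apply/esym/mdist_positivity/eqP; rewrite eq_le mdist_ge0 andbT.
have := zmin (f z); rewrite inE => /(_ (fB _ Bz)).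
have := fk z (f z); have := mdist_ge0 z (f z); move: (mdist z (f z)) => m m0 h1 h2.
have : (1 - k) * m <= 0 by lra.
by rewrite pmulr_rle0// subr_gt0.
Unshelve. all: by end_near. Qed.

Definition quasi_similarity (R : realType) (X : metricType R) (M lam : R)
    (f : X -> X) : Prop :=
  0 < lam /\ forall u v, simeq M (mdist (f u) (f v)) (lam * mdist u v).

Lemma quasi_similarity_comp (R : realType) (X : metricType R)
    (K L lam mu : R) (f g : X -> X) : 0 < K -> 0 < L ->
  quasi_similarity K lam f -> quasi_similarity L mu g ->
  quasi_similarity (K * L) (lam * mu) (g \o f).
Proof.
move=> K0 L0 [lam0 fl] [mu0 gm]; split=> [|u v]; first exact: mulr_gt0.
rewrite mulrC [lam * _]mulrC -[mu * _ * _]mulrA /=.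
apply: simeq_trans (gm _ _) _ => //.
by apply: simeq_mul2l => //; exact: ltW.
Qed.

Lemma quasi_similarity_inverse (R : realType) (X : metricType R)
    (M lam : R) (f g : X -> X) : 0 < M -> cancel g f ->
  quasi_similarity M lam f -> quasi_similarity M lam^-1 g.
Proof.
move=> M0 gK [lam0 fl]; split=> [|u v]; first by rewrite invr_gt0.
have := fl (g u) (g v); rewrite !gK => /(simeq_sym M0).
have lami0 : 0 <= lam^-1 by rewrite invr_ge0 ltW.
by move=> /(simeq_mul2l M0 lami0); rewrite mulKf// gt_eqF.
Qed.

(** The constants do not accumulate: [M * lam < 1] makes f itself a contraction
and [M < lam] makes its inverse one. *)
Lemma quasi_similarity_fixpoint (R : realType) (X : metricType R)
    (M lam : R) (f g : X -> X) (x0 : X) : proper_space X -> 1 <= M ->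
  cancel g f -> quasi_similarity M lam f ->
  ~~ (M^-1 <= lam <= M) -> exists z, f z = z.
Proof.
move=> Xproper M1 gK qf; have M0 : 0 < M by exact: lt_le_trans M1.
have [lam0 _] := qf.
have contracts nu (h : X -> X) :
    quasi_similarity M nu h -> M * nu < 1 -> exists z, h z = z.
  move=> [nu0 hnu] k1; apply: (@contraction_fixpoint _ _ (M * nu) h x0) => //.
    by apply: mulr_ge0; exact: ltW.
  by move=> u v; rewrite -mulrA; have /(simeqP _ _ M0)[] := hnu u v.
rewrite negb_and -!ltNge => /orP[small|big].
  by apply: contracts qf _; rewrite mulrC -ltr_pdivlMr// mul1r.
have [|z zfix] := contracts _ _ (quasi_similarity_inverse M0 gK qf).
  by rewrite ltr_pdivrMr// mul1r.
by exists z; rewrite -{1}zfix gK.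
Qed.

(** The scales of the given maps are arbitrary.  A map of extreme scale has a
fixed point, hence conjugating its inverse by a map of any scale gives a map
that undoes this scale while fixing the target y. *)
Lemma quasi_similarity_biLipschitz_homogeneous (R : realType)
    (X : metricType R) (M : R) : proper_space X -> 1 <= M ->
  (forall x y : X, exists f g lam,
    [/\ cancel f g, cancel g f, f x = y & quasi_similarity M lam f]) ->
  uniformly_biLipschitz_homogeneous X.
Proof.
move=> Xproper M1 homog; have M0 : 0 < M by exact: lt_le_trans M1.
have MM1 : 1 <= M * M by rewrite (le_trans M1)// ler_peMl// ltW.
have MMMM1 : 1 <= M * M * (M * M).
  by rewrite (le_trans MM1)// ler_peMl// ltW// mulr_gt0.
have MMMM0 : 0 < M * M * (M * M) by exact: lt_le_trans MMMM1.
exists (M * M * (M * M)) => // x y.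
have [f [g [lam [fK gK fx qf]]]] := homog x y.
have [tame|wild] := boolP (M^-1 <= lam <= M).
  exists f.
  have fM u v : simeq (M * M * (M * M)) (mdist (f u) (f v)) (mdist u v).
    apply: (@simeq_weaken _ (M * M)); rewrite ?mulr_gt0 ?mdist_ge0//.
      by rewrite ler_peMl// ltW// mulr_gt0.
    apply: simeq_trans (qf.2 u v) _ => //.
    move: tame; rewrite -(ler_pM2l M0) divff ?gt_eqF// => /andP[ge le].
    apply/simeqP => //; split; first by rewrite ler_wpM2r ?mdist_ge0.
    by rewrite mulrA ler_peMl ?mdist_ge0.
  by split => //; exact: biLipschitz_homeomorphism fM.
have [z zfix] := quasi_similarity_fixpoint x Xproper M1 gK qf wild.
have [h [k [mu [hK kK hz qh]]]] := homog z y.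
(* x goes to y, then to z, stays at z and returns to y. *)
pose F := h \o (g \o (k \o f)).
have [_ FM] : quasi_similarity (M * M * (M * M)) 1 F.
  have lam0 := qf.1; have mu0 := qh.1.
  have -> : 1 = lam * mu^-1 * (lam^-1 * mu).
    by rewrite mulrACA -[lam * _ * _]mulrA; field; rewrite !gt_eqF.
  rewrite /F (_ : h \o _ = (h \o g) \o (k \o f))//.
  apply: quasi_similarity_comp; rewrite ?mulr_gt0//.
    exact: quasi_similarity_comp (quasi_similarity_inverse M0 kK qh).
  exact: quasi_similarity_comp (quasi_similarity_inverse M0 gK qf) qh.
have {}FM u v : simeq (M * M * (M * M)) (mdist (F u) (F v)) (mdist u v).
  by have := FM u v; rewrite mul1r.
exists F; split => //.
- apply: (@biLipschitz_homeomorphism _ _ _ _ (g \o (h \o (f \o k)))) FM => //.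
  + by move=> u; rewrite /F /= hK gK kK fK.
  + by move=> u; rewrite /F /= gK hK fK kK.
- by rewrite /F /= fx -[in k y]hz hK -[in g z]zfix fK.
Qed.

(** * Quasi-inversions of a punctured space *)

Lemma punctureP (R : realType) (X : metricType R) (p x : X) :
  x != p -> exists x' : [set~ p], set_val x' = x.
Proof.
move=> /eqP xp; have xP : x \in [set~ p] by apply/mem_set.
by exists (SigSub xP).
Qed.

Lemma puncture_neq (R : realType) (X : metricType R) (p : X) (x : [set~ p]) :
  set_val x != p.
Proof. by apply/eqP; exact: (set_mem (valP x)). Qed.

(** The pullback of the distance by an ideal inversion at p of radius 1. *)
Definition inverted_dist (R : realType) (X : metricType R) (p x y : X) : R :=
  mdist x y / (mdist x p * mdist y p).

(** Thus the inverted distance from x to a point y far away is about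
1/d(x,p). *)
Lemma inverted_dist_bounds (R : realType) (X : metricType R) (p x y : X) :
  x != p -> y != p ->
  (mdist x p)^-1 - (mdist y p)^-1 <= inverted_dist p x y
    <= (mdist x p)^-1 + (mdist y p)^-1.
Proof.
rewrite -!(@mdist_gt0 R) => xp yp.
have x0 := lt0r_neq0 xp; have y0 := lt0r_neq0 yp.
have -> : (mdist x p)^-1 - (mdist y p)^-1 =
    (mdist y p - mdist x p) / (mdist x p * mdist y p).
  by field; rewrite x0 y0.
have -> : (mdist x p)^-1 + (mdist y p)^-1 =
    (mdist x p + mdist y p) / (mdist x p * mdist y p).
  by field; rewrite x0 y0.
have xy0 : 0 < mdist x p * mdist y p by rewrite mulr_gt0.
have h1 := metric_triangle y x p; have h2 := metric_triangle x p y.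
rewrite (metric_sym y x) in h1; rewrite (metric_sym p y) in h2.
by rewrite /inverted_dist !ler_pM2r ?invr_gt0//; apply/andP; split; lra.
Qed.

Lemma inversion_continuous (R : realType) (X : metricType R) (p : X) (L : R)
    (s : [set~ p] -> [set~ p]) : 0 <= L ->
  (forall x y : [set~ p], mdist (set_val (s x)) (set_val (s y)) <=
     L * inverted_dist p (set_val x) (set_val y)) ->
  continuous s.
Proof.
move=> L0 sL; apply: continuous_comp_initial => x.
have xp : 0 < mdist (set_val x) p.
  by rewrite mdist_gt0; apply/eqP; exact: (set_mem (valP x)).
pose r := mdist (set_val x) p / 2.
have r0 : 0 < r by rewrite divr_gt0.
apply: (@locally_lipschitz_continuous _ _ _ _ set_val _ r
    (L / (mdist (set_val x) p * r))) => //.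
  exact: initial_continuous.
move=> t xt /=; apply: le_trans (sL x t) _.
rewrite -mulrA ler_wpM2l// mulrC.
rewrite ler_wpM2l ?mdist_ge0//.
have tp : r <= mdist (set_val t) p.
  by have := metric_triangle (set_val x) (set_val t) p; rewrite /r in xt *; lra.
have tp0 := lt_le_trans r0 tp.
by rewrite lef_pV2 ?posrE ?mulr_gt0// ler_pM2l.
Qed.

Lemma unbounded_far (R : realType) (X : metricType R) (p : X) (M : R) :
  unbounded_space X -> exists x : X, M < mdist x p.
Proof.
move=> Xunbounded; apply: contrapT => far; apply: Xunbounded.
exists (M + M) => x y; have le z : mdist z p <= M.
  by rewrite leNgt; apply/negP => zM; apply: far; exists z.
have := metric_triangle x p y; rewrite (metric_sym p y).
by have := le x; have := le y; lra.
Qed.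

(** The images of points going to infinity stay in a bounded set, hence
accumulate at some w.  If w were another point than p, it would be s(v) for
some v, but d(s(v),s(y)) is at least about 1/(L d(v,p)) for y far away. *)
Lemma inversion_infinity_to_center (R : realType) (X : metricType R) (p : X)
    (L e : R) (s t : [set~ p] -> [set~ p]) : proper_space X ->
  unbounded_space X -> 1 <= L -> cancel t s ->
  (forall x y : [set~ p], simeq L (mdist (set_val (s x)) (set_val (s y)))
    (inverted_dist p (set_val x) (set_val y))) ->
  0 < e ->
  exists y : [set~ p], (mdist (set_val y) p)^-1 < e /\
    mdist p (set_val (s y)) < e.
Proof.
move=> Xproper Xunbounded L1 tK sL.
have L0 : 0 < L by exact: lt_le_trans L1.
have /choice[y yn] : forall n, exists y : [set~ p],
    n.+1%:R < mdist (set_val y) p.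
  move=> n; have [x nx] := unbounded_far p n.+1%:R Xunbounded.
  have /punctureP[x' x'E] : x != p by rewrite -(@mdist_gt0 R) (le_lt_trans _ nx).
  by exists x'; rewrite x'E.
pose a n := (mdist (set_val (y n)) p)^-1.
have aV n : a n < n.+1%:R^-1 by rewrite ltf_pV2 ?posrE// (lt_trans _ (yn n)).
pose c := set_val (s (y 0)).
have ball n : mdist c (set_val (s (y n))) <= L * (1 + 1).
  have /(simeqP _ _ L0)[le _] := sL (y 0) (y n).
  have /andP[_ le'] :=
    inverted_dist_bounds (puncture_neq (y 0)) (puncture_neq (y n)).
  apply: le_trans le _; rewrite ler_pM2l//; apply: le_trans le' _.
  have a1 m : a m <= 1.
    by apply: le_trans (ltW (aV m)) _; rewrite invf_le1// ler1n.
  apply: lerD; [exact: (a1 0%N)|exact: a1].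
have [w [_ clw]] := Xproper c (L * (1 + 1)) ((set_val \o s \o y) @ \oo) _
  (filterE _ ball).
have approx (e' : R) : 0 < e' ->
    exists n, a n < e' /\ mdist w (set_val (s (y n))) < e'.
  move=> e'0.
  have An : \forall n \near \oo, a n < e'.
    near=> n; apply: lt_trans (aV n) _.
    by near: n; exact: near_infty_natSinv_lt (PosNum e'0).
  have wB : nbhs w [set z | mdist w z < e'].
    by apply/metricType_numDomainType.nbhs_mdistP; exists e'.
  have FA : ((set_val \o s \o y) @ \oo)
      ((set_val \o s \o y) @` [set n | a n < e']).
    by apply: filterS An => n an; exists n.
  by have [_ [[n an <-] /= wn]] := clw _ _ FA wB; exists n.
suff wp : w = p.
  by move=> e0; have [n] := approx e e0; rewrite wp; exists (y n).
apply/eqP; apply: contrapT => /negP/punctureP[w' w'E].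
pose v := t w'; have vp : 0 < mdist (set_val v) p.
  by rewrite mdist_gt0 puncture_neq.
(* If 1/d(y,p) and d(w, s y) are both less than e, then 1/d(v,p) < (L + 1) e. *)
have d0 : 0 < (mdist (set_val v) p)^-1 / (L + 1).
  by rewrite divr_gt0 ?invr_gt0// ltr_wpDl// ltW.
have [n [an wn]] := approx _ d0.
have /(simeqP _ _ L0)[_] := sL v (y n).
rewrite /v tK w'E => h1.
have /andP[h2 _] := inverted_dist_bounds (puncture_neq v) (puncture_neq (y n)).
have h3 := le_trans h2 h1.
move: d0 an wn h3; rewrite -/(a n); move: (a n) (_^-1) (mdist w _).
move=> an vi wn d0; rewrite !ltr_pdivlMr ?ltr_wpDl ?(ltW L0)// => h4 h5 h6.
have L10 : 0 <= L + 1 by lra.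
have := ler_wpM2l L10 h6.
have h7 : L * (wn * (L + 1)) < L * vi by rewrite ltr_pM2l.
by lra.
Unshelve. all: by end_near. Qed.

(** The limit, as y goes to infinity, of the comparison of d(s(x),s(y)) with the
inverted distance. *)
Lemma inversion_norm (R : realType) (X : metricType R) (p : X) (L : R)
    (s t : [set~ p] -> [set~ p]) : proper_space X -> unbounded_space X ->
  1 <= L -> cancel t s ->
  (forall x y : [set~ p], simeq L (mdist (set_val (s x)) (set_val (s y)))
    (inverted_dist p (set_val x) (set_val y))) ->
  forall x, simeq L (mdist (set_val (s x)) p) (mdist (set_val x) p)^-1.
Proof.
move=> Xproper Xunbounded L1 tK sL x.
have L0 : 0 < L by exact: lt_le_trans L1.
have L10 : 0 < L + 1 by lra.
apply/simeqP => //; split; apply/ler_addgt0Pl => e e0.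
(* Each bound loses L times one of 1/d(y,p) and d(p, s y), plus the other. *)
all: have e'0 : 0 < e / (L + 1) by rewrite divr_gt0.
all: have [y []] :=
  inversion_infinity_to_center Xproper Xunbounded L1 tK sL e'0.
all: have eE : e = (L + 1) * (e / (L + 1)) by rewrite mulrC divfK ?gt_eqF.
all: move: (e / _) eE => e' -> ye sye.
all: have /(simeqP _ _ L0)[h1 h2] := sL x y.
all: have /andP[h3 h4] := inverted_dist_bounds (puncture_neq x) (puncture_neq y).
all: have h5 := metric_triangle (set_val (s x)) (set_val (s y)) p.
all: have h6 := metric_triangle (set_val (s x)) p (set_val (s y)).
all: rewrite (metric_sym (set_val (s y)) p) in h5.
- have h7 := ler_wpM2l (ltW L0) h4.
  have h8 := ler_wpM2l (ltW L0) (ltW ye).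
  by rewrite mulrDr in h7; lra.
- have h7 := ler_wpM2l (ltW L0) h6.
  have h8 := ler_wpM2l (ltW L0) (ltW sye).
  by rewrite mulrDr in h7; lra.
Qed.

(** * Conformal extensions to the point at infinity *)

Lemma biLipschitz_conformal (R : realType) (X : metricType R) (L : R)
    (f : X -> X) : 1 <= L ->
  (forall u v, simeq L (mdist (f u) (f v)) (mdist u v)) ->
  conformal L (@extended_dist R X) (omap f).
Proof.
move=> L1 fL; exists (fun=> 1) => // -[x|] [y|]; rewrite /pullback !mul1r //=.
all: exact: simeq_refl.
Qed.

Lemma inversion_extension (R : realType) (X : metricType R) (p : X)
    (s t : [set~ p] -> [set~ p]) : cancel s t -> cancel t s ->
  exists f g : option X -> option X,
    [/\ cancel f g, cancel g f, f None = Some p, f (Some p) = None &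
      forall x, f (Some (set_val x)) = Some (set_val (s x))].
Proof.
move=> sK tK.
have ext (h : [set~ p] -> [set~ p]) : exists f : option X -> option X,
    [/\ f None = Some p, f (Some p) = None &
      forall x, f (Some (set_val x)) = Some (set_val (h x))].
  have /choice[f fP] : forall x : X, exists u : option X,
      (x = p -> u = None) /\
      forall x' : [set~ p], set_val x' = x -> u = Some (set_val (h x')).
    move=> x; have [->|/punctureP[x' <-]] := eqVneq x p.
      by exists None; split=> // x' x'p; have := puncture_neq x'; rewrite x'p eqxx.
    exists (Some (set_val (h x'))); split=> [x'p|x'' /val_inj-> //].
    by have := puncture_neq x'; rewrite x'p eqxx.
  exists (fun u => if u is Some x then f x else Some p); split=> [//||x].
    exact: (fP p).1.
  exact: (fP _).2.
have [f [f0 fp fs]] := ext s; have [g [g0 gp gt]] := ext t.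
exists f, g; split=> //.
all: move=> [x|]; rewrite ?f0 ?g0 ?fp ?gp//.
all: have [->|/punctureP[x' <-]] := eqVneq x p; first by rewrite ?fp ?gp ?f0 ?g0.
all: by rewrite ?fs ?gt ?fs ?sK ?tK.
Qed.

(** The conformal factor is 1/d(x,p) away from p and infinity, the value it must
have on pairs (x, p); on the pair (p, infinity), whose points are swapped, the
factor 1 is right. *)
Lemma inversion_conformal (R : realType) (X : metricType R) (p : X) (L : R)
    (s : [set~ p] -> [set~ p]) (f : option X -> option X) : 1 <= L ->
  (forall x y : [set~ p], simeq L (mdist (set_val (s x)) (set_val (s y)))
    (inverted_dist p (set_val x) (set_val y))) ->
  (forall x, simeq L (mdist (set_val (s x)) p) (mdist (set_val x) p)^-1) ->
  f None = Some p -> f (Some p) = None ->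
  (forall x, f (Some (set_val x)) = Some (set_val (s x))) ->
  conformal L (@extended_dist R X) f.
Proof.
move=> L1 sL sp f0 fp fs.
pose w (u : option X) : R :=
  if u is Some x then if x == p then 1 else (mdist x p)^-1 else 1.
exists w => [[x|]|] //=.
  by case: eqVneq => // xp; rewrite invr_gt0 mdist_gt0.
have wp : w (Some p) = 1 by rewrite /w eqxx.
have ws (x : [set~ p]) : w (Some (set_val x)) = (mdist (set_val x) p)^-1.
  by rewrite /w (negPf (puncture_neq x)).
have V0 (x : [set~ p]) : mdist (set_val x) p != 0.
  by rewrite lt0r_neq0// mdist_gt0 puncture_neq.
have cases (u : option X) : [\/ u = None, u = Some p |
    exists x : [set~ p], u = Some (set_val x)].
  case: u => [x|]; last by constructor 1.
  have [->|/punctureP[x' <-]] := eqVneq x p; first by constructor 2.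
  by constructor 3; exists x'.
move=> u v; rewrite /pullback.
have [->|->|[x ->]] := cases u; have [->|->|[y ->]] := cases v;
  rewrite ?f0 ?fp ?fs ?wp ?ws /= ?mdistxx ?mulr0 ?mulr1 ?mul1r.
- exact: simeq_refl.
- exact: simeq_refl.
- by rewrite metric_sym.
- exact: simeq_refl.
- exact: simeq_refl.
- by rewrite (metric_sym p) mulVf//; exact: simeq_refl.
- exact: sp.
- by rewrite mulVf//; exact: simeq_refl.
- by have := sL x y; rewrite /inverted_dist invfM mulrC.
Qed.

(** The inversion i sends q to infinity, so y reaches infinity through q.  Then
the image of x is finite and is moved to q by a map that fixes infinity. *)
Lemma pair_to_center_infinity (R : realType) (X : metricType R) (K L : R)
    (q : X) (i j : option X -> option X) : 1 <= K -> 1 <= L ->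
  (forall x y : X, exists f : X -> X, [/\ homeomorphism f, f x = y &
    forall u v : X, simeq K (mdist (f u) (f v)) (mdist u v)]) ->
  cancel i j -> cancel j i -> i (Some q) = None ->
  conformal L (@extended_dist R X) i ->
  forall x y : option X, x != y -> exists f g : option X -> option X,
    [/\ cancel f g, cancel g f, conformal (K * L * K) (@extended_dist R X) f,
        f x = Some q & f y = None].
Proof.
move=> K1 L1 homog iK jK iq iL.
have K0 : 0 < K by exact: lt_le_trans K1.
have L0 : 0 < L by exact: lt_le_trans L1.
have move_to_q (x : X) : exists f g : option X -> option X,
    [/\ cancel f g, cancel g f, f None = None, f (Some x) = Some q &
        conformal K (@extended_dist R X) f].
  have [f [[_ [g [fK gK _]]] fx fL]] := homog x q.
  exists (omap f), (omap g); split=> //=; last exact: biLipschitz_conformal.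
  - exact: omapK.
  - exact: omapK.
  - by rewrite fx.
have KLK : K <= K * L * K by rewrite ler_peMl ?mulr_ege1// ltW.
move=> x [y|].
  have [f [f' [fK f'K f0 fy fL]]] := move_to_q y.
  case ifx : (i (f x)) => [z|] xy; last first.
    case/eqP: xy; apply: (can_inj fK); apply: (can_inj iK).
    by rewrite ifx fy iq.
  have [h [h' [hK h'K h0 hz hL]]] := move_to_q z.
  exists (h \o (i \o f)), (f' \o (j \o h')); split.
  - by move=> u; rewrite /= hK iK fK.
  - by move=> u; rewrite /= f'K jK h'K.
  - apply: conformal_comp; rewrite ?mulr_gt0//.
    exact: conformal_comp.
  - by rewrite /= ifx.
  - by rewrite /= fy iq h0.
case: x => [x|//] _.
have [f [f' [fK f'K f0 fx fL]]] := move_to_q x.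
exists f, f'; split=> //.
by apply: conformal_weaken fL => //; exact: extended_dist_ge0.
Qed.

(** * Strongly quasi-Moebius maps fixing or swapping infinity *)

(** Since infinity is fixed, its cross-ratio with a, b, c says that the
dilatation d(phi u, phi v)/d(u, v) changes by at most K when one end of the
pair (u, v) is replaced.  Two replacements relate any two pairs. *)
Lemma Moebius_fixing_infinity_quasi_similarity (R : realType)
    (X : metricType R) (K : R) (f : option X -> option X) (phi : X -> X)
    (x0 y0 : X) : 1 <= K -> x0 != y0 -> injective phi ->
  f None = None -> (forall x, f (Some x) = Some (phi x)) ->
  (forall a b c e, uniq [:: a; b; c; e] ->
    cross_ratio (pullback f (@extended_dist R X)) a b c e <=
    K * cross_ratio (@extended_dist R X) a b c e) ->
  exists lam, quasi_similarity (K * K) lam phi.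
Proof.
move=> K1 xy0 phi_inj finf fphi fK.
have K0 : 0 < K by exact: lt_le_trans K1.
have pos (x y : X) : x != y -> 0 < mdist x y :> R by rewrite mdist_gt0.
have base a b c : mdist (phi a) (phi c) * mdist b c <=
    K * (mdist a c * mdist (phi b) (phi c)).
  have [->|ab] := eqVneq a b.
    rewrite [X in X <= _]mulrC.
    by rewrite ler_peMl// mulr_ge0 ?mdist_ge0.
  have [->|ac] := eqVneq a c; first by rewrite !mdistxx !mul0r mulr0.
  have [->|bc] := eqVneq b c; first by rewrite !mdistxx !mulr0.
  have := fK (Some a) (Some b) (Some c) None.
  rewrite /cross_ratio /pullback finf !fphi /= !inE /= => /(_ _).
  rewrite !(inj_eq Some_inj) (negPf ab) (negPf ac) (negPf bc) /= => /(_ isT).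
  rewrite !mulr1 !mul1r ler_pdivrMr ?pos ?inj_eq// mulrA mulrAC.
  by rewrite ler_pdivlMr ?pos// -mulrA.
(* Pairs are compared through (u, c), or through (v, c) when u = c. *)
have four a c u v : u != v -> mdist (phi a) (phi c) * mdist u v <=
    K * K * (mdist a c * mdist (phi u) (phi v)).
  move=> uv; have [uc|uc] := eqVneq u c.
    subst u; rewrite (metric_sym c v) (metric_sym (phi c)).
    apply: le_trans (base a v c) _; rewrite ler_wpM2r ?ler_peMl//.
      by rewrite mulr_ge0 ?mdist_ge0.
    exact: ltW.
  rewrite -(ler_pM2l (pos _ _ uc)).
  have h1 := ler_wpM2r (mdist_ge0 u v) (base a u c).
  have := ler_wpM2l (mulr_ge0 (ltW K0) (mdist_ge0 a c)) (base c v u).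
  rewrite (metric_sym v) (metric_sym c u) (metric_sym (phi c)) (metric_sym (phi v)).
  by move: h1; lra.
pose lam := mdist (phi x0) (phi y0) / mdist x0 y0.
have d0 := pos _ _ xy0.
have lam0 : 0 < lam by rewrite divr_gt0// pos// inj_eq.
exists lam; split=> // u v; apply/simeqP; first exact: mulr_gt0.
have [->|uv] := eqVneq u v; first by rewrite !mdistxx !mulr0.
have -> : lam * mdist u v =
    mdist (phi x0) (phi y0) * mdist u v / mdist x0 y0 by rewrite /lam mulrAC.
split; first by rewrite mulrA ler_pdivlMr// (mulrC (mdist (phi x0) _)); exact: four.
by rewrite ler_pdivrMr// -[leRHS]mulrA [_ * mdist x0 y0]mulrC; exact: four.
Qed.

(** The cross-ratio of x, p, y and infinity compares d(s x, s y) with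
N(x) d(x,y)/(d(x,p) d(y,p)), where N(x) = d(s x, p) d(x, p).  Exchanging x and y
shows that N is constant up to a factor. *)
Lemma Moebius_swapping_infinity_inversion (R : realType) (X : metricType R)
    (K : R) (p x0 : X) (f : option X -> option X) : 1 <= K -> x0 != p ->
  injective f -> f None = Some p -> f (Some p) = None ->
  (forall a b c e, uniq [:: a; b; c; e] ->
    cross_ratio (pullback f (@extended_dist R X)) a b c e <=
    K * cross_ratio (@extended_dist R X) a b c e) ->
  exists s : [set~ p] -> [set~ p],
    (forall x, f (Some (set_val x)) = Some (set_val (s x))) /\
    exists2 L : R, 1 <= L & forall x y : [set~ p],
      simeq L (mdist (set_val (s x)) (set_val (s y)))
        (inverted_dist p (set_val x) (set_val y)).
Proof.
move=> K1 x0p f_inj finf fp fK; have K0 : 0 < K by exact: lt_le_trans K1.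
have /choice[s fs] : forall x : [set~ p], exists y : [set~ p],
    f (Some (set_val x)) = Some (set_val y).
  move=> x; case fx : (f (Some (set_val x))) => [y|].
    have /punctureP[y' <-] : y != p; last by exists y'.
    by apply/eqP => yp; move: fx; rewrite yp -finf => /f_inj.
  by have := puncture_neq x; move: fx; rewrite -fp => /f_inj[->]; rewrite eqxx.
exists s; split => //.
have pos (x y : X) : x != y -> 0 < mdist x y :> R by rewrite mdist_gt0.
have posp (x : [set~ p]) : 0 < mdist (set_val x) p :> R.
  by apply: pos; exact: puncture_neq.
have s_inj (x y : [set~ p]) : set_val x != set_val y ->
    set_val (s x) != set_val (s y).
  by apply: contra_neq => sxy; move: (fs x); rewrite sxy -fs => /f_inj[].
(* An ideal inversion of radius r has N = r^2. *)
pose N (x : [set~ p]) : R := mdist (set_val (s x)) p * mdist (set_val x) p.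
have N0 x : 0 < N x by rewrite mulr_gt0.
have base x y : simeq K (mdist (set_val (s x)) (set_val (s y)))
    (N x * inverted_dist p (set_val x) (set_val y)).
  have -> : N x * inverted_dist p (set_val x) (set_val y) =
      mdist (set_val (s x)) p * mdist (set_val x) (set_val y) /
      mdist (set_val y) p.
    rewrite /N /inverted_dist; have := gt_eqF (posp x); have := gt_eqF (posp y).
    by move=> y0 x0'; field; rewrite y0 x0'.
  have [xy|xy] := eqVneq (set_val x) (set_val y).
    by rewrite (val_inj xy) !mdistxx mulr0 mul0r; exact: simeq_refl.
  have xp := puncture_neq x; have yp := puncture_neq y.
  apply/simeqP => //; split.
    have := fK (Some (set_val x)) (Some p) (Some (set_val y)) None.
    rewrite /cross_ratio /pullback finf fp !fs /= !inE /= => /(_ _).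
    rewrite !(inj_eq Some_inj) (negPf xp) (negPf xy) (eq_sym p) (negPf yp) /=.
    move=> /(_ isT); rewrite !mulr1 !mul1r ler_pdivrMr//.
    by rewrite (metric_sym p); lra.
  have := fK (Some p) (Some (set_val x)) (Some (set_val y)) None.
  rewrite /cross_ratio /pullback finf fp !fs /= !inE /= => /(_ _).
  rewrite !(inj_eq Some_inj) (eq_sym p) (negPf xp) (negPf xy).
  rewrite (eq_sym p) (negPf yp) /=.
  move=> /(_ isT); rewrite !mulr1 !mul1r.
  rewrite ler_pdivrMr ?pos ?s_inj// mulrA mulrAC ler_pdivlMr ?pos//.
  by rewrite ler_pdivrMr// (metric_sym p) [K * _ * _]mulrAC.
have NN x y : simeq (K * K) (N x) (N y).
  have [xy|xy] := eqVneq (set_val x) (set_val y).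
    by rewrite (val_inj xy); apply: simeq_refl; rewrite ?(ltW (N0 _))// mulr_ege1.
  have I0 : 0 < inverted_dist p (set_val x) (set_val y).
    by rewrite divr_gt0 ?mulr_gt0// pos.
  have Ii0 : 0 <= (inverted_dist p (set_val x) (set_val y))^-1.
    by rewrite invr_ge0 ltW.
  rewrite -[N x](mulfK (lt0r_neq0 I0)) -[N y](mulfK (lt0r_neq0 I0)) ![_ / _]mulrC.
  apply: simeq_mul2l => //; first exact: mulr_gt0.
  apply: simeq_trans (simeq_sym K0 (base x y)) _ => //.
  have -> : inverted_dist p (set_val x) (set_val y) =
      inverted_dist p (set_val y) (set_val x).
    by rewrite /inverted_dist metric_sym [X in _ / X]mulrC.
  by rewrite metric_sym.
have [x0' _] := punctureP x0p.
(* Absorbs the radius of the inversion, on which nothing is known. *)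
pose c := Num.max (N x0') (N x0')^-1.
have c1 : 1 <= c.
  have [h|h] := leP 1 (N x0'); first by rewrite /c le_max h.
  by rewrite /c le_max invf_ge1// (ltW h) orbT.
have c0 : 0 < c by exact: lt_le_trans c1.
have KKK1 : 1 <= K * (K * K) by rewrite !mulr_ege1.
have KKK0 : 0 < K * (K * K) by exact: lt_le_trans KKK1.
exists (K * (K * K) * c) => [|x y]; first by rewrite mulr_ege1.
have I0 : 0 <= inverted_dist p (set_val x) (set_val y).
  by rewrite divr_ge0 ?mulr_ge0 ?mdist_ge0.
apply: (@simeq_trans _ _ _ _
  (N x0' * inverted_dist p (set_val x) (set_val y))) => //.
  apply: simeq_trans (base x y) _; rewrite ?mulr_gt0//.
  rewrite ![N _ * _]mulrC; apply: simeq_mul2l => //; exact: mulr_gt0.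
apply/simeqP => //; split; first by rewrite ler_wpM2r// le_max lexx.
rewrite mulrA ler_peMl// -[1](mulVf (lt0r_neq0 (N0 x0'))).
by rewrite ler_pM2r// le_max lexx orbT.
Qed.

Theorem proposition1p6 (R : realType) (X : metricType R)
    (Xproper : proper_space X) (Xunbounded : unbounded_space X)
    (p : X) (dh : quasi_sphericalized_distance p) :
  (uniformly_biLipschitz_homogeneous X /\ quasi_invertible X) <->
  two_point_uniformly_strongly_quasi_Moebius_homogeneous (sphericalization dh).
Proof.
have [x0 x0p] : exists x0 : X, x0 != p.
  by have [x] := unbounded_far p 0 Xunbounded; rewrite mdist_gt0; exists x.
have dd := sphericalization_conformally_equivalent dh.
split.
- move=> [[K K1 homog] [q [L [L1 [s [[_ [t [sK tK _]]] sL]]]]]].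
  have [i [j [iK jK i0 iq iS]]] := inversion_extension sK tK.
  have sq := inversion_norm Xproper Xunbounded L1 tK sL.
  have iL := inversion_conformal L1 sL sq i0 iq iS.
  have to_q := pair_to_center_infinity K1 L1 homog iK jK iq iL.
  set M := K * L * K in to_q.
  have M1 : 1 <= M by rewrite !mulr_ege1.
  have M0 : 0 < M by exact: lt_le_trans M1.
  (* The two factors 4 pay for passing from the sphericalization to rho and
     back. *)
  pose N := 4 * (M * M * 4).
  have N1 : 1 <= N by rewrite /N !mulr_ege1// ler1n.
  have N0 : 0 < N by exact: lt_le_trans N1.
  exists (N ^+ 4); first exact: exprn_ege1.
  move=> x y a b xy ab.
  have [f [f' [fK f'K fM fx fy]]] := to_q x y xy.
  have [g [g' [gK g'K gM ga gb]]] := to_q a b ab.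
  have transfer h : conformal (M * M) (@extended_dist R X) h ->
      conformal N (@mdist R (sphericalization dh)) h.
    move=> hM; have h4 : 0 < 4 :> R by [].
    have MM0 : 0 < M * M by exact: mulr_gt0.
    have MM40 : 0 < M * M * 4 by exact: mulr_gt0.
    apply: conformally_equivalent_trans h4 MM40
      (conformally_equivalent_pullback h dd) _.
    apply: conformally_equivalent_trans MM0 _ hM _ => //.
    exact: conformally_equivalent_sym.
  have FM : conformal N (@mdist R (sphericalization dh)) (g' \o f).
    by apply: transfer; apply: conformal_comp => //; exact: conformal_inverse gM.
  have FK : cancel (g' \o f) (f' \o g) by move=> u /=; rewrite g'K fK.
  have F'K : cancel (f' \o g) (g' \o f) by move=> u /=; rewrite f'K gK.
  have bounded (u v : sphericalization dh) : mdist u v <= 1.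
    exact: sphericalization_bounded.
  have other (u : sphericalization dh) : exists v, v != u.
    by case: u => [u|]; [exists None | exists (Some p)].
  have cont := conformal_continuous N0 bounded other.
  exists (g' \o f); split => //.
  + split; first exact: cont FM.
    exists (f' \o g); split => //.
    exact: cont (conformal_inverse N0 F'K FM).
  + exact: conformal_strongly_quasi_Moebius.
  + by rewrite /= fx -ga gK.
  + by rewrite /= fy -gb gK.
- move=> [C C1 homog].
  have C0 : 0 < C by exact: lt_le_trans C1.
  pose K : R := 4 ^+ 4 * (C * 4 ^+ 4).
  have P1 : 1 <= 4 ^+ 4 :> R by rewrite exprn_ege1// ler1n.
  have K1 : 1 <= K by do 2 ! apply: mulr_ege1 => //.
  have cross (f : sphericalization dh -> sphericalization dh) a b c e :
      strongly_quasi_Moebius C f -> uniq [:: a; b; c; e] ->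
      cross_ratio (pullback f (@extended_dist R X)) a b c e <=
      K * cross_ratio (@extended_dist R X) a b c e.
    move=> fC abce; rewrite /K -(mulrA (4 ^+ 4)) -(mulrA C).
    exact: strongly_quasi_Moebius_extended_dist.
  split.
    apply: (@quasi_similarity_biLipschitz_homogeneous _ _ (K * K)) => //.
      by rewrite mulr_ege1.
    move=> x y.
    have [f [[_ [g [fK gK _]]] fC fx f0]] :=
      homog (Some x) None (Some y) None isT isT.
    have g0 : g None = None by rewrite -[in g None]f0 fK.
    have finite h h' : cancel h h' -> h None = None ->
        exists phi : X -> X, forall x, h (Some x) = Some (phi x).
      move=> hK h0.
      suff /choice[phi] : forall x : X, exists y : X, h (Some x) = Some y.
        by exists phi.
      move=> z; case hz : (h (Some z)) => [z'|]; first by exists z'.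
      by move: hz; rewrite -h0 => /(can_inj hK).
    have [phi phiE] := finite f g fK f0; have [psi psiE] := finite g f gK g0.
    have phiK : cancel phi psi.
      by move=> z; apply: Some_inj; rewrite -psiE -phiE fK.
    have psiK : cancel psi phi.
      by move=> z; apply: Some_inj; rewrite -phiE -psiE gK.
    have [lam phi_lam] := Moebius_fixing_infinity_quasi_similarity K1 x0p
      (can_inj phiK) f0 phiE (fun a b c e => @cross f a b c e fC).
    by exists phi, psi, lam; split=> //; apply: Some_inj; rewrite -phiE.
  have [f [[_ [g [fK gK _]]] fC fp f0]] :=
    homog (Some p) None None (Some p) isT isT.
  have gC := strongly_quasi_Moebius_inverse C0 gK fC.
  have gp : g (Some p) = None by rewrite -f0 fK.
  have g0 : g None = Some p by rewrite -[in g None]fp fK.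
  have [s [fs [L L1 sL]]] := Moebius_swapping_infinity_inversion K1 x0p
    (can_inj fK) f0 fp (fun a b c e => @cross f a b c e fC).
  have [t [gt [L' L'1 tL]]] := Moebius_swapping_infinity_inversion K1 x0p
    (can_inj gK) g0 gp (fun a b c e => @cross g a b c e gC).
  have cont M (r : [set~ p] -> [set~ p]) : 1 <= M ->
      (forall x y : [set~ p], simeq M (mdist (set_val (r x)) (set_val (r y)))
        (inverted_dist p (set_val x) (set_val y))) -> continuous r.
    move=> M1 rM; have M0 : 0 < M by exact: lt_le_trans M1.
    apply: (@inversion_continuous _ _ _ M) => [|x y]; first exact: ltW.
    by have /(simeqP _ _ M0)[] := rM x y.
  exists p, L; split=> //; exists s; split; last exact: sL.
  split; first exact: cont sL.
  exists t; split; last exact: cont tL.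
    by move=> x; apply: val_inj; apply: Some_inj; rewrite -gt -fs fK.
  by move=> x; apply: val_inj; apply: Some_inj; rewrite -fs -gt gK.
Qed.
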